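(* If $p,q\ge 2$ are integers, then $\Gamma_{p,q}$ is a $(2p-2)$-STI graph.
   Context: The transmission of a vertex $u$ of a connected graph $G$ is $\mathrm{Tr}_G(u)=\sum_{x\in V(G)} d_G(u,x)$, where $d_G$ is the shortest-path distance. For an integer $k\ge 1$, a connected finite simple graph $G$ is a $k$-STI graph if $|\mathrm{Tr}_G(x)-\mathrm{Tr}_G(y)|=k$ for every edge $xy\in E(G)$. Write $[m]=\{1,\dots,m\}$. For $p,q\ge 2$, $\Gamma_{p,q}$ is the graph with vertex set $\{v_i, w_{i,j} : i\in[2q],\ j\in[p]\}$ and edge set $$\{v_iw_{i,j},\ v_iw_{i-1,j} : 2\le i\le 2q-1,\ j\in[p]\}\cup\{v_iw_{i,j} : i\in\{1,2q\},\ j\in[p]\}\cup\{v_1w_{2q,j},\ v_{2q}w_{2q-1,j} : j\in[p]\}.$$ (Equivalently, $2q$ copies of $K_{2,p}$ attached in a circular manner: each $w_{i,j}$ is adjacent exactly to $v_i$ and $v_{i+1}$, where $v_{2q+1}=v_1$.) *)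

(* Defs.v *)
From mathcomp Require Import all_boot all_order all_algebra.

Set Implicit Arguments.
Unset Strict Implicit.
Unset Printing Implicit Defensive.

Section Graph.
Variables (T : finType) (e : rel T).

Definition has_path_of_length (x y : T) (n : nat) : bool :=
  [exists s : n.-tuple T, [&& path e x s, last x s == y & uniq (x :: s)]].

(* A path with distinct vertices has fewer than #|T| edges, so searching
   0, ..., #|T|.-1 finds the least length; the junk value #|T| is returned
   exactly when y is not reachable from x. *)
Definition dist (x y : T) : nat :=
  find (has_path_of_length x y) (iota 0 #|T|).

Definition transmission (u : T) : nat := \sum_(x : T) dist u x.

Definition simple_graph : Prop := symmetric e /\ irreflexive e.

Definition connected_graph : Prop :=
  0 < #|T| /\ forall x y : T, connect e x y.

Definition STI (k : nat) : Prop :=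
  [/\ 0 < k, simple_graph, connected_graph
    & forall x y : T, e x y ->
        (`|(transmission x)%:Z - (transmission y)%:Z| = k%:Z)%R].

End Graph.

(* Indices are shifted by one: [inl i] is v_(i+1) and [inr (i, j)] is
   w_(i+1, j+1). *)
Definition Gamma_vertex (p q : nat) : finType :=
  ('I_(2 * q) + 'I_(2 * q) * 'I_p)%type.

(* Adjacency of v_a and w_(b, j), for 1-based a and b and for every j. *)
Definition Gamma_vw (q a b : nat) : bool :=
  [|| (2 <= a <= 2 * q - 1) && ((b == a) || (b == a - 1)),
      ((a == 1) || (a == 2 * q)) && (b == a),
      (a == 1) && (b == 2 * q)
    | (a == 2 * q) && (b == 2 * q - 1)].

Definition Gamma (p q : nat) : rel (Gamma_vertex p q) :=
  fun x y =>
    match x, y with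
    | inl i, inr (k, _) | inr (k, _), inl i => Gamma_vw q i.+1 k.+1
    | _, _ => false
    end.

Arguments Gamma p q x y : clear implicits.

(* Main.v *)
Require Import Defs.
From mathcomp Require Import all_boot all_order all_algebra.
From mathcomp Require Import zify.

(** Put v_i at position 2i and all the w_(i,j) at position 2i+1 of a cycle of
    length 4q.  Adjacency is then cyclic distance 1, and the graph distance is
    the cyclic distance, except that two distinct vertices at the same position
    are at distance 2.  From any position, the cyclic distances to the even
    positions and to the odd positions have the same sum S (which is 2q^2), so
    that Tr(v) = S + pS and Tr(w) = S + pS + 2(p-1). *)

Section DistanceCharacterization.
Variables (T : finType) (e : rel T) (D : T -> T -> nat).
Hypothesis Dxx : forall x, D x x = 0.
Hypothesis D_eq0 : forall x y, D x y = 0 -> x = y.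
Hypothesis D_lipschitz : forall x y z, e x y -> D x z <= (D y z).+1.
Hypothesis D_descent :
  forall x y, 0 < D x y -> exists2 z, e x z & D x y = (D z y).+1.

Lemma path_size_ge x s : path e x s -> D x (last x s) <= size s.
Proof.
elim: s x => [|y s IHs] x /=; first by rewrite Dxx.
by case/andP=> exy /IHs le_s; rewrite (leq_trans (D_lipschitz _ _ _ exy)).
Qed.

Lemma geodesic_path x y :
  exists s, [/\ path e x s, last x s = y & size s = D x y].
Proof.
have [n] := ubnP (D x y); elim: n x => // n IHn x ltn.
case: (posnP (D x y)) => [D0|]; first by exists [::]; rewrite (D_eq0 _ _ D0) Dxx.
case/D_descent=> z exz Dz.
case: (IHn z) => [|s [ps ls ss]]; first by rewrite Dz in ltn.
by exists (z :: s); split; rewrite //= ?exz // ss Dz.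
Qed.

(** The Lipschitz condition bounds the length of every path from x to y below by [D x y], and
    repeated descent builds a path of exactly that length. *)
Lemma dist_unique x y : dist e x y = D x y.
Proof.
(* [dist] searches only repetition-free paths. Removing repetitions from the geodesic cannot shorten
   it, since its length is already minimal. *)
have [s0 [/shortenP[s ps us sub_s] ls ss]] := geodesic_path x y.
have sz_s : size s = D x y.
  apply/eqP; rewrite eqn_leq -{1}ss -ls path_size_ge // andbT.
  by apply: uniq_leq_size sub_s; case/andP: us.
(* Hence [D x y] lies in the range searched by [dist], away from its junk value. *)
have lt_D : D x y < #|T| by have := max_card (mem (x :: s)); rewrite (card_uniqP us) /= sz_s.
have hasD : has_path_of_length e x y (D x y).
  have sz_s' : size s == D x y by rewrite sz_s.
  by apply/existsP; exists (Tuple sz_s'); apply/and3P; split=> //; apply/eqP.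
rewrite /dist; set a := has_path_of_length e x y.
have has_a : has a (iota 0 #|T|).
  by apply/hasP; exists (D x y); rewrite ?mem_iota.
apply/eqP; rewrite eqn_leq; apply/andP; split.
  rewrite leqNgt; apply/negP=> /(before_find 0).
  by rewrite nth_iota // add0n /a hasD.
have := nth_find 0 has_a; rewrite nth_iota -?has_find ?size_iota // ?add0n.
  by case/existsP=> t /and3P[/path_size_ge + /eqP le_t _]; rewrite le_t size_tuple.
by rewrite -{2}(size_iota 0 #|T|) -has_find.
Qed.

Lemma descent_connect x y : connect e x y.
Proof. by have [s [ps <- _]] := geodesic_path x y; apply/connectP; exists s. Qed.

End DistanceCharacterization.

(** With truncated subtraction, [(a - b) + (b - a)] is |a - b|. *)
Definition cdist (n a b : nat) : nat :=
  minn ((a - b) + (b - a)) (n - ((a - b) + (b - a))).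

Lemma cdist_descent n a b : 0 < cdist n a b -> a < n -> b < n ->
  exists c, [/\ c < n, cdist n a c = 1 & cdist n a b = (cdist n c b).+1].
Proof.
move=> D_gt0 lt_a lt_b; rewrite /cdist in D_gt0 *.
have [near|far] := leqP (2 * ((a - b) + (b - a))) n.
  by have [ab|ba] := ltnP a b; [exists a.+1 | exists a.-1]; split; lia.
(* The shorter arc now crosses from n-1 to 0, so the step leads away from b, wrapping around at the
   end of the range. *)
have [ab|ba] := ltnP a b.
  by have [a0|a_gt0] := posnP a; [exists n.-1 | exists a.-1]; split; lia.
by have [an|a_lt] := eqVneq a.+1 n; [exists 0 | exists a.+1]; split; lia.
Qed.

Lemma cdist_sum_even_odd q a : a < 4 * q ->
  let S := \sum_(k < q) (4 * k + 2) in
  \sum_(k < 2 * q) cdist (4 * q) a (2 * k) = S /\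
  \sum_(k < 2 * q) cdist (4 * q) a (2 * k).+1 = S.
Proof.
move=> lt_a /=; elim: a lt_a => [|a IHa] lt_a.
  (* Seen from 0, the k-th position of a parity class from the start and the k-th from the end are
     at distances 2k and 2k+2 (even) or 2k+1 twice (odd); both pairs add up to 4k+2. *)
  rewrite mul2n -addnn !big_split_ord /=.
  split; rewrite [X in _ + X](reindex_inj rev_ord_inj) -big_split /=;
    by apply: eq_bigr => k _; have := ltn_ord k; rewrite /cdist; lia.
(* Rotating by one swaps the classes: odd positions seen from a+1 look like even ones seen from a,
   and even ones like odd ones, with 0 matching 4q-1. Hence the first term is split off on one side
   and the last on the other. *)
have [<- <-] := IHa (ltnW lt_a); split; last first.
  by apply: eq_bigr => k _; rewrite /cdist; lia.
have [m eq_m] : exists m, 2 * q = m.+1 by exists (2 * q).-1; lia.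
rewrite eq_m big_ord_recl [RHS]big_ord_recr /= addnC; congr (_ + _).
  by apply: eq_bigr => k _; rewrite /cdist /bump /=; have := ltn_ord k; lia.
by rewrite /cdist; lia.
Qed.

Section GammaDistance.
Variables p q : nat.
Hypotheses (hp : 2 <= p) (hq : 2 <= q).

Definition Gamma_pos (x : Gamma_vertex p q) : nat :=
  match x with inl i => 2 * i | inr (k, _) => (2 * k).+1 end.

Lemma Gamma_pos_lt x : Gamma_pos x < 4 * q.
Proof.
by case: x => [i|[k j]] /=; [have := ltn_ord i | have := ltn_ord k]; lia.
Qed.

Lemma Gamma_pos_surj n : n < 4 * q -> exists x, Gamma_pos x = n.
Proof.
move=> lt_n; have lt_h : n./2 < 2 * q by lia.
case: (boolP (odd n)) => odd_n; last by exists (inl (Ordinal lt_h)) => /=; lia.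
by exists (inr (Ordinal lt_h, Ordinal (ltnW hp))) => /=; lia.
Qed.

(** The clauses of [Gamma_vw] for 1 and 2q are the wrap-around. Vertices of the same kind have
    positions of equal parity, so, 4q being even, their cyclic distance is never 1. *)
Lemma Gamma_cdist x y :
  Gamma p q x y = (cdist (4 * q) (Gamma_pos x) (Gamma_pos y) == 1).
Proof.
have vw (i k : 'I_(2 * q)) :
    Gamma_vw q i.+1 k.+1 = (cdist (4 * q) (2 * i) (2 * k).+1 == 1).
  by have := ltn_ord i; have := ltn_ord k; rewrite /Gamma_vw /cdist; lia.
case: x y => [i|[k j]] [i'|[k' j']] //=; rewrite ?vw // /cdist.
- by have := ltn_ord i; have := ltn_ord i'; lia.
- by congr (_ == _); lia.
- by have := ltn_ord k; have := ltn_ord k'; lia.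
Qed.

Definition Gamma_dist (x y : Gamma_vertex p q) : nat :=
  cdist (4 * q) (Gamma_pos x) (Gamma_pos y)
  + 2 * ((x != y) && (Gamma_pos x == Gamma_pos y)).

Lemma Gamma_dist_eq0 x y : Gamma_dist x y = 0 -> x = y.
Proof.
have := Gamma_pos_lt x; have := Gamma_pos_lt y; rewrite /Gamma_dist /cdist.
by case: eqP => //= _; case: eqP; lia.
Qed.

Lemma Gamma_dist_lipschitz x y z :
  Gamma p q x y -> Gamma_dist x z <= (Gamma_dist y z).+1.
Proof.
have := Gamma_pos_lt x; have := Gamma_pos_lt y; have := Gamma_pos_lt z.
rewrite Gamma_cdist /Gamma_dist /cdist.
by case: (x != z); case: (y != z) => /=; lia.
Qed.

Lemma Gamma_dist_descent x y : 0 < Gamma_dist x y ->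
  exists2 z, Gamma p q x z & Gamma_dist x y = (Gamma_dist z y).+1.
Proof.
have [lt_x lt_y] := (Gamma_pos_lt x, Gamma_pos_lt y).
have [eq_pos|ne_pos] := eqVneq (Gamma_pos x) (Gamma_pos y).
  rewrite /Gamma_dist eq_pos eqxx andbT => D_gt0.
  have x_ne_y : x != y by move: D_gt0; rewrite /cdist; case: (x != y); lia.
  (* Any neighbour of x serves, being at distance 1 from y too. *)
  have [c lt_c c1] : exists2 c, c < 4 * q & cdist (4 * q) (Gamma_pos y) c = 1.
    exists (if Gamma_pos y == 0 then 1 else (Gamma_pos y).-1);
    by rewrite /cdist; case: eqP; lia.
  have [z zc] := Gamma_pos_surj _ lt_c.
  exists z; first by rewrite Gamma_cdist eq_pos zc c1.
  by rewrite x_ne_y zc; move: c1; rewrite /cdist; case: (z != y) => /=; lia.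
rewrite /Gamma_dist (negPf ne_pos) andbF muln0 addn0 => D_gt0.
have [c [lt_c c1 Dc]] := cdist_descent _ _ _ D_gt0 lt_x lt_y.
(* Once the position of y is reached, the vertex chosen must be y itself: any other one there is at
   distance 2 from y. *)
have [c_y|c_ne_y] := eqVneq c (Gamma_pos y).
  exists y; first by rewrite Gamma_cdist -c_y c1.
  by rewrite Dc c_y !eqxx muln0 addn0.
have [z zc] := Gamma_pos_surj _ lt_c.
exists z; first by rewrite Gamma_cdist zc c1.
by rewrite zc (negPf c_ne_y) andbF muln0 addn0.
Qed.

Lemma Gamma_dist_xx x : Gamma_dist x x = 0.
Proof. by rewrite /Gamma_dist /cdist eqxx; lia. Qed.

Lemma dist_Gamma x y : dist (Gamma p q) x y = Gamma_dist x y.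
Proof.
apply: dist_unique; [exact: Gamma_dist_xx | exact: Gamma_dist_eq0
  | exact: Gamma_dist_lipschitz | exact: Gamma_dist_descent].
Qed.

Lemma connect_Gamma x y : connect (Gamma p q) x y.
Proof.
apply: descent_connect; [exact: Gamma_dist_xx | exact: Gamma_dist_eq0
  | exact: Gamma_dist_descent].
Qed.

Lemma Gamma_sym : symmetric (Gamma p q).
Proof. by case=> [i|[k j]] [i'|[k' j']]. Qed.

Lemma Gamma_irr : irreflexive (Gamma p q).
Proof. by case=> [i|[k j]]. Qed.

(** Each even position carries one vertex and each odd position carries p. *)
Lemma sum_cdist_Gamma_pos x :
  \sum_y cdist (4 * q) (Gamma_pos x) (Gamma_pos y)
  = p.+1 * \sum_(k < q) (4 * k + 2).
Proof.
have [evenS oddS] := cdist_sum_even_odd _ _ (Gamma_pos_lt x).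
rewrite (mulSn p) big_sumType evenS; congr (_ + _).
rewrite -oddS big_distrr /=.
rewrite (eq_bigr (fun y : 'I_(2 * q) * 'I_p =>
  cdist (4 * q) (Gamma_pos x) (2 * y.1).+1)); last by case.
rewrite -(pair_bigA _ (fun (k : 'I_(2 * q)) (j : 'I_p) =>
  cdist (4 * q) (Gamma_pos x) (2 * k).+1)) /=.
by apply: eq_bigr => k _; rewrite sum_nat_const card_ord.
Qed.

Lemma transmission_Gamma x : transmission (Gamma p q) x =
  p.+1 * (\sum_(k < q) (4 * k + 2))
  + 2 * #|[set y | (x != y) && (Gamma_pos x == Gamma_pos y)]|.
Proof.
rewrite -(sum_cdist_Gamma_pos x) -sum1dep_card big_distrr /= [X in _ + X]big_mkcond.
rewrite -big_split; apply: eq_bigr => y _; rewrite dist_Gamma /Gamma_dist.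
by case: (_ && _).
Qed.

Lemma transmission_v i : transmission (Gamma p q) (inl i) =
  p.+1 * (\sum_(k < q) (4 * k + 2)).
Proof.
rewrite transmission_Gamma (_ : [set y | _] = set0) ?cards0; first by lia.
apply/setP=> -[i'|[k j]]; rewrite !inE /=; last by lia.
by apply/negbTE/andP=> -[/eqP ne /eqP eq_i]; apply/ne/congr1/val_inj => /=; lia.
Qed.

Lemma transmission_w w : transmission (Gamma p q) (inr w) =
  p.+1 * (\sum_(k < q) (4 * k + 2)) + 2 * p.-1.
Proof.
case: w => k j; rewrite transmission_Gamma.
rewrite (_ : [set y | _] = [set inr (k, j') | j' in [set~ j]]).
  by rewrite card_imset ?cardsC1 ?card_ord // => a b [].
apply/setP=> y; rewrite !inE; apply/idP/imsetP.
  case: y => [i|[k' j']] /andP[/eqP ne /eqP /= eq_k]; first by lia.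
  have ekk : k = k' by apply: val_inj => /=; lia.
  by exists j'; rewrite ?ekk // !inE; apply/eqP=> ej; apply: ne; rewrite ej ekk.
case=> j' + ->; rewrite !inE /= eqxx andbT => ne_j.
by apply: contra ne_j => /eqP[->].
Qed.

End GammaDistance.

Theorem proposition4p2 (p q : nat) (hp : 2 <= p) (hq : 2 <= q) :
  STI (Gamma p q) (2 * p - 2).
Proof.
split; first by lia.
- by split; [exact: Gamma_sym | exact: Gamma_irr].
- split; last exact: connect_Gamma.
  have [|x _] := Gamma_pos_surj p q hp hq 0; first by lia.
  by apply/card_gt0P; exists x.
(* Only v-w pairs are edges; naming the common part of both transmissions leaves a linear goal. *)
by case=> [i|[k j]] [i'|[k' j']] //= _;
  rewrite (transmission_v p q hp hq) (transmission_w p q hp hq); move: (p.+1 * _) => S; lia.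
Qed.
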